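(* There is a constant $c$ such that every graph $G$ with treewidth $k$ and maximum degree $\Delta\geq 1$ satisfies $\pi(G)\leq ck\Delta$ and $\sigma(G)\leq ck\Delta^3$.
   Context: All graphs are simple, finite and undirected. Write $[t]=\{1,\dots,t\}$. A walk in $G$ is a sequence $v_1,\dots,v_t$ of vertices such that $v_iv_{i+1}\in E(G)$ for all $i\in[t-1]$. It is a path if its vertices are pairwise distinct. A $k$-colouring of $G$ is a function assigning one of $k$ colours to each vertex. A walk $v_1,\dots,v_{2t}$ ($t\ge1$) is repetitively coloured by a colouring $f$ if $f(v_i)=f(v_{t+i})$ for all $i\in[t]$; it is boring if $v_i=v_{t+i}$ for all $i\in[t]$. $\pi(G)$ is the minimum $k$ such that $G$ has a $k$-colouring for which no path of $G$ is repetitively coloured. $\sigma(G)$ is the minimum $k$ such that $G$ has a $k$-colouring for which every repetitively coloured walk is boring. The treewidth of $G$ is the minimum integer $k$ such that $G$ is a subgraph of a chordal graph with no clique on $k+2$ vertices. *)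

(* Defs.v *)
From mathcomp Require Import all_boot.
From mathcomp Require Import boolp.

Set Implicit Arguments.
Unset Strict Implicit.
Unset Printing Implicit Defensive.

Record sgraph := SGraph {
  svertex :> finType;
  adj : rel svertex;
  adj_sym : symmetric adj;
  adj_irrefl : irreflexive adj }.

Definition degree (G : sgraph) (x : G) : nat := #|[set y | adj x y]|.

Definition max_degree (G : sgraph) : nat := \max_(x : G) degree x.

Definition is_walk (G : sgraph) (w : seq G) : bool := sorted (@adj G) w.

Definition is_path (G : sgraph) (w : seq G) : bool := is_walk w && uniq w.

(* A walk with 2t vertices is a (t + t)-tuple: its i-th vertex sits at
   [lshift t i] and its (t + i)-th vertex at [rshift t i]. *)
Definition rep_coloured (G : sgraph) (k : nat) (f : G -> 'I_k)
    (t : nat) (w : (t + t).-tuple G) : Prop :=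
  forall i : 'I_t, f (tnth w (lshift t i)) = f (tnth w (rshift t i)).

Definition boring (G : sgraph) (t : nat) (w : (t + t).-tuple G) : Prop :=
  forall i : 'I_t, tnth w (lshift t i) = tnth w (rshift t i).

Definition path_nonrepetitive (G : sgraph) (k : nat) (f : G -> 'I_k) : Prop :=
  forall (t : nat) (w : (t + t).-tuple G),
    0 < t -> is_path w -> ~ rep_coloured f w.

Definition walk_nonrepetitive (G : sgraph) (k : nat) (f : G -> 'I_k) : Prop :=
  forall (t : nat) (w : (t + t).-tuple G),
    0 < t -> is_walk w -> rep_coloured f w -> boring w.

Definition path_colourable (G : sgraph) (k : nat) : Prop :=
  exists f : G -> 'I_k, path_nonrepetitive f.

Definition walk_colourable (G : sgraph) (k : nat) : Prop :=
  exists f : G -> 'I_k, walk_nonrepetitive f.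

Definition is_clique (G : sgraph) (A : {set G}) : Prop :=
  {in A &, forall x y, x != y -> adj x y}.

(* Every cycle of length at least 4 has a chord: an edge joining two vertices
   of the cycle that are not consecutive on it. *)
Definition chordal (G : sgraph) : Prop :=
  forall c : seq G, ucycle (@adj G) c -> 4 <= size c ->
  exists x y : G,
    [/\ x \in c, y \in c, adj x y, y != next c x & x != next c y].

Definition is_subgraph (G H : sgraph) : Prop :=
  exists2 h : G -> H, injective h & forall x y : G, adj x y -> adj (h x) (h y).

Definition treewidth_le (G : sgraph) (k : nat) : Prop :=
  exists H : sgraph, [/\ is_subgraph G H, chordal H &
    forall A : {set H}, is_clique A -> #|A| <> k + 2].

Lemma walk_colourable_card (G : sgraph) : walk_colourable G #|G|.
Proof. by exists enum_rank => t w _ _ rw i; apply: enum_rank_inj. Qed.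

Lemma walk_path_colourable (G : sgraph) (k : nat) :
  walk_colourable G k -> path_colourable G k.
Proof.
case=> f fP; exists f => t w t0 /andP[ww uw] rw.
move/tuple_uniqP: uw => /(_ _ _ (fP t w t0 ww rw (Ordinal t0))) /(congr1 val) /=.
by rewrite addn0 => t_eq0; rewrite -t_eq0 in t0.
Qed.

Definition complete_graph (T : finType) : sgraph.
Proof.
exists T (fun x y => x != y); first by move=> x y; rewrite eq_sym.
by move=> x; rewrite eqxx.
Defined.

Lemma complete_graph_chordal (T : finType) : chordal (complete_graph T).
Proof.
case=> [|x [|y [|z [|t c]]]] //= /andP[_ /= uc] _.
exists x, z; move: uc; rewrite /= !inE !negb_or.
move=> /andP[/and4P[xy xz xt _] /andP[/and3P[yz _ _] _]].
split; rewrite ?mem_head ?inE ?eqxx ?orbT //=.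
  by rewrite eq_sym.
by rewrite ![z == _]eq_sym (negPf xz) (negPf yz).
Qed.

Lemma treewidth_le_card (G : sgraph) : treewidth_le G #|G|.
Proof.
exists (complete_graph G); split; last 1 first.
- by move=> A _ cA; have := max_card (mem A); rewrite cA addn2 ltnNge leqnSn.
- exists id => // x y xy; apply/eqP => x_y; move: xy.
  by rewrite x_y adj_irrefl.
- exact: complete_graph_chordal.
Qed.

Lemma ex_path_colourable (G : sgraph) : exists k, `[< path_colourable G k >].
Proof.
exists #|G|; apply/asboolP/walk_path_colourable; exact: walk_colourable_card.
Qed.

Lemma ex_walk_colourable (G : sgraph) : exists k, `[< walk_colourable G k >].
Proof. by exists #|G|; apply/asboolP/walk_colourable_card. Qed.

Lemma ex_treewidth_le (G : sgraph) : exists k, `[< treewidth_le G k >].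
Proof. by exists #|G|; apply/asboolP/treewidth_le_card. Qed.

Definition pi_num (G : sgraph) : nat := ex_minn (ex_path_colourable G).

Definition sigma_num (G : sgraph) : nat := ex_minn (ex_walk_colourable G).

(* The graph with no vertices gets treewidth 0 here, instead of -1; every other
   graph has treewidth at least 0. *)
Definition treewidth (G : sgraph) : nat := ex_minn (ex_treewidth_le G).

(* Main.v *)
Require Import Defs.
From mathcomp Require Import all_boot.
From mathcomp Require Import boolp zify.

Set Implicit Arguments.
Unset Strict Implicit.
Unset Printing Implicit Defensive.

(** Why the theorem holds.  Let [w] be the treewidth plus one and [D] the maximum
degree.

A tree-partition of [G] groups the vertices into bags, indexed by the nodes of a
rooted forest, so that every edge lies in one bag or joins a bag to its parent.
[exists_layering] builds one whose bags have at most [24 * w * D] vertices.  It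
is found together with a prescribed set [S] lying in the root bag.  If [S] is
small, [S] is the root bag, and the neighbours of [S] are prescribed for the
rest of the graph; the factor [D] is lost here.  If [S] is large, a clique of a
chordal supergraph, hence at most [w] vertices, splits [S] into two parts of at
most two thirds each ([treewidth_separation]), both sides are treated
recursively, and the two root bags are merged ([glue_layering]).

Given the tree-partition, a vertex is coloured by a colour of the depth of its
bag and by its index inside the bag.  Along a walk the depth changes by at most
one per step.  The twelve colours of depths are chosen so that a repetitively
coloured lazy walk on the natural numbers is boring ([lazy_walk_boring]).  So a
repetitively coloured walk [v_1, ..., v_2t] repeats its depths; where the depth
of [v_j] is minimal, the stretch from [v_j] to [v_(t+j)] reaches no smaller
depth, so it stays in the subtree of the bag of [v_j] and ends in that very bag.
As both ends have the same index, [v_j = v_(t+j)] ([layer_colour_meets]).  No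
path does this, which gives the bound on [pi_num].

For [sigma_num], add a colouring in which distinct vertices with a common
neighbour differ; [D ^ 2 + 1] colours suffice greedily.  Then
[v_j = v_(t+j)] spreads to the neighbouring positions, hence to all of them. *)

(** * A colouring of the natural numbers for lazy walks *)

(** The regular paperfolding sequence: for [n.+1 = 2 ^ e * (2 * q + 1)] the value
is the parity of [q]. *)
Definition fold_bit (n : nat) : bool := odd (n.+1 %/ 2 ^ (logn 2 n.+1).+1).

Lemma fold_bitE n e q : n.+1 = 2 ^ e * (2 * q + 1) -> fold_bit n = odd q.
Proof.
move=> nE; rewrite /fold_bit nE lognM ?expn_gt0 //; last by rewrite addn1.
rewrite lognX logn_prime // eqxx muln1.
have /eqP -> : logn 2 (2 * q + 1) == 0.
  by rewrite -leqn0 leqNgt logn_gt0 mem_primes; apply/negP => /and3P[_ _]; lia.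
by rewrite addn0 expnSr divnMl ?expn_gt0 //; congr (odd _); lia.
Qed.

(** The paperfolding sequence has no square of even period.  Write the period [m]
as [2 ^ e.+1 * o] with [o] odd.  Every window of length [m] contains a position
with [x.+1 = 2 ^ e * (2 * q + 1)], and the shift by [m] replaces [q] by [q + o],
which has the other parity. *)
Lemma fold_bit_square a m : 0 < m -> ~~ odd m ->
  exists2 x, a <= x < a + m & fold_bit x != fold_bit (x + m).
Proof.
move=> m_gt0 m_even; have [o o_odd mE] := pfactor_coprime (isT : prime 2) m_gt0.
rewrite coprime2n in o_odd.
have [e eE] : exists e, logn 2 m = e.+1.
  by case: (logn 2 m) mE => [|e] mE; [rewrite mE muln1 o_odd in m_even | exists e].
rewrite {}eE expnS in mE; set M := 2 ^ e in mE.
have M_gt0 : 0 < M by rewrite expn_gt0.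
(* The least number above [a] that is congruent to [M] modulo [2 * M] is
   [M * (2 * q + 1)]. *)
pose q := (a + M) %/ (2 * M).
have := divn_eq (a + M) (2 * M); have := @ltn_pmod (a + M) (2 * M).
rewrite -/q => /(_ ltac:(lia)) r_lt aE.
have o_gt0 : 0 < o by case: (o) o_odd.
have M_le : 2 * M <= m by rewrite mE leq_pmull.
exists (M * (2 * q + 1)).-1; first by apply/andP; split; nia.
have xE : ((M * (2 * q + 1)).-1).+1 = M * (2 * q + 1) by nia.
rewrite (fold_bitE xE) (@fold_bitE _ e (q + o)); last first.
  by rewrite -addSn xE mE -/M; nia.
by rewrite oddD o_odd addbT; case: odd.
Qed.

Lemma discrete_ivt (d : nat -> nat) n x :
  (forall i, i < n -> d i <= (d i.+1).+1 /\ d i.+1 <= (d i).+1) ->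
  minn (d 0) (d n) <= x <= maxn (d 0) (d n) -> exists2 i, i <= n & d i = x.
Proof.
elim: n => [|n IHn] stp x_bd; first by exists 0 => //; lia.
have [|x_out] := boolP (minn (d 0) (d n) <= x <= maxn (d 0) (d n)).
  by case/IHn=> [i i_lt|i i_le dx]; [apply: stp; lia | exists i => //; lia].
by exists n.+1 => //; have := stp n (leqnn _); lia.
Qed.

(** Of the residue modulo 6, the part modulo 3 tells in which direction a lazy
walk moves, and the part modulo 2 forces the shift between the two halves of a
repetitively coloured walk to be even. *)
Definition depth_colour (n : nat) : 'I_6 * bool := (inord (n %% 6), fold_bit n).

Lemma depth_colour_inj m n : depth_colour m = depth_colour n ->
  m %% 6 = n %% 6 /\ fold_bit m = fold_bit n.
Proof.
case=> /(congr1 val) /=; rewrite !inordK ?ltn_pmod //.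
Qed.

(** As the residues modulo 3 determine every step, the second half of the walk is
a translate of the first, say by [m].  The first half visits all [m] levels
between its start and the start of the second half, so a nonzero [m] would give
a square of period [m] in [fold_bit]; and [m] is even. *)
Lemma lazy_walk_boring (d : nat -> nat) t :
  (forall i, i.+1 < t + t -> d i <= (d i.+1).+1 /\ d i.+1 <= (d i).+1) ->
  (forall i, i < t -> depth_colour (d i) = depth_colour (d (t + i))) ->
  forall i, i < t -> d i = d (t + i).
Proof.
move=> stp rep.
have shift i : i < t -> d (t + i) + d 0 = d t + d i.
  elim: i => [|i IHi] i_lt; first by rewrite addn0.
  have [m6 _] := depth_colour_inj (rep i (ltnW i_lt)).
  have [m6' _] := depth_colour_inj (rep i.+1 i_lt).
  have := stp i ltac:(lia); have := stp (t + i) ltac:(lia).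
  have := IHi (ltnW i_lt); move: m6'; rewrite addnS; lia.
have stp' i : i < t -> d i <= (d i.+1).+1 /\ d i.+1 <= (d i).+1.
  by move=> i_lt; apply: stp; lia.
move=> j j_lt; have t_gt0 : 0 < t by lia.
have [m6 _] := depth_colour_inj (rep 0 t_gt0); rewrite addn0 in m6.
have [dt_lt|d0_lt|d_eq] := ltngtP (d t) (d 0); last 1 first.
- by have := shift j j_lt; lia.
- have at_level x : d t < x <= d 0 -> exists2 i, i < t & d i = x.
    move=> x_bd; have [|i i_le dx] := @discrete_ivt d t x stp'; first by lia.
    by exists i => //; rewrite ltn_neqAle i_le andbT; apply/eqP => ie; subst i; lia.
  (* The walk reaches the level [d t].+1 in its first half and, translated, in its
     second: this is why the square below starts at a natural number. *)
  have [|i0 i0_lt di0] := at_level (d t).+1; first by rewrite leqnn.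
  have := shift i0 i0_lt; rewrite di0 => le_dt.
  have [||x x_bd /eqP[]] := @fold_bit_square ((d t).+1 - (d 0 - d t)) (d 0 - d t);
    [lia|lia|].
  have [|i i_lt dx] := at_level (x + (d 0 - d t)); first by lia.
  have [_] := depth_colour_inj (rep i i_lt); rewrite dx => ->.
  by congr fold_bit; have := shift i i_lt; lia.
have [||x x_bd /eqP[]] := @fold_bit_square (d 0) (d t - d 0); [lia|lia|].
have [|i i_le dx] := @discrete_ivt d t x stp'; first by lia.
have i_lt : i < t by rewrite ltn_neqAle i_le andbT; apply/eqP => ie; subst; lia.
have [_] := depth_colour_inj (rep i i_lt); rewrite dx => ->.
by congr fold_bit; have := shift i i_lt; lia.
Qed.

(** * Induced paths and chords *)

Lemma connect_preserves (T : finType) (e : rel T) (P : pred T) x y :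
  (forall a b, P a -> e a b -> P b) -> connect e x y -> P x -> P y.
Proof.
move=> P_step /connectP[p]; elim: p x => [|z p IHp] x /=; first by move=> _ ->.
by case/andP=> xz pth lst Px; apply: (IHp z) => //; apply: P_step xz.
Qed.

Lemma induced_path (T : finType) (e : rel T) x y : connect e x y ->
  exists s, [/\ path e x s, last x s = y, uniq (x :: s) &
    forall i j, i < j <= size s ->
      e (nth x (x :: s) i) (nth x (x :: s) j) -> j = i.+1].
Proof.
case/connectP=> p0 pth0 ->; case/shortenP: pth0 => p pth uq _.
have [n le_n] := ubnP (size p); elim: n p pth uq le_n => // n IHn p pth uq le_n.
have [/existsP[i /existsP[j /and3P[lt_ij eij ne_ij]]]|ind] := boolP
  [exists i : 'I_(size p).+1, exists j : 'I_(size p).+1,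
    [&& i < j, e (nth x (x :: p) i) (nth x (x :: p) j) & (j : nat) != i.+1]];
  last first.
  exists p; split=> // i j /andP[lt_ij le_j] eij; apply/eqP; apply: contraNT ind.
  move=> ne_ij; apply/existsP; exists (Ordinal (leq_trans lt_ij (leqW le_j))).
  by apply/existsP; exists (Ordinal (le_j : j < (size p).+1)); rewrite lt_ij eij.
case: i j lt_ij eij ne_ij => i i_lt [[//|j] j_lt] /= lt_ij eij ne_ij.
have jE : drop j p = nth x p j :: drop j.+1 p by rewrite (drop_nth x).
have lstE : last x (take i p) = nth x (x :: p) i.
  case: i {eij ne_ij} i_lt lt_ij => [|i] i_lt lt_ij; first by rewrite take0.
  by rewrite (last_nth x) size_takel //= nth_take.
pose q := take i p ++ drop j p.
have lst_q : last x q = last x p.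
  by rewrite -[in RHS](cat_take_drop j p) !last_cat jE.
rewrite -lst_q; apply: IHn.
- move: (pth); rewrite -{1}(cat_take_drop i p) cat_path => /andP[pth1 _].
  rewrite cat_path pth1 jE /= lstE eij /=.
  by move: pth; rewrite -{1}(cat_take_drop j p) cat_path jE => /andP[_ /andP[]].
- apply: subseq_uniq uq; rewrite /= eqxx -[X in subseq _ X](cat_take_drop i p).
  rewrite /q cat_subseq //.
  have /subnK <- : i <= j by rewrite -ltnS.
  by rewrite -drop_drop drop_subseq.
- by rewrite size_cat size_takel ?size_drop; lia.
Qed.

(** This is how chordality is contradicted: a cycle whose only adjacent pairs of
positions are the cyclically consecutive ones has no chord. *)
Lemma chord_of_induced (T : eqType) (e : rel T) (x0 : T) (c : seq T) a b :
  symmetric e -> irreflexive e ->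
  (forall i j, i < j < size c -> e (nth x0 c i) (nth x0 c j) ->
    j = i.+1 \/ i = 0 /\ j.+1 = size c) ->
  a \in c -> b \in c -> e a b -> b = next c a \/ a = next c b.
Proof.
move=> e_sym e_irr ind.
wlog lt_ab : a b / index a c < index b c => [wl ac bc ab|ac bc ab].
  have [/wl|/wl|eq_ab] := ltngtP (index a c) (index b c); first exact.
    by rewrite e_sym => /(_ bc ac ab) []; [right|left].
  by move: ab; rewrite -(nth_index x0 ac) eq_ab nth_index // e_irr.
have := ind _ _ _ _; move/(_ (index a c) (index b c)).
rewrite lt_ab index_mem bc !nth_index // => /(_ isT ab).
rewrite !next_nth ac bc; case: c ac bc lt_ab {ind} => // z c ac bc lt_ab.
case=> [ib|[ia ib]].
  by left; rewrite -{1}(nth_index z bc) ib.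
right; rewrite -{1}(nth_index z ac) ia [RHS]nth_default //.
by rewrite -ltnS ib.
Qed.

(** * Balanced clique separators of chordal graphs *)

Section Separators.
Variable H : sgraph.
Implicit Types (X A S : {set H}).

Definition avoiding X : rel H := [rel x y | [&& adj x y, x \notin X & y \notin X]].

Definition component X (u : H) : {set H} := [set y | connect (avoiding X) u y].

Lemma avoiding_sym X : symmetric (avoiding X).
Proof. by move=> x y; rewrite /avoiding /= adj_sym [(x \notin X) && _]andbC. Qed.

Lemma component_notin X u y : u \notin X -> y \in component X u -> y \notin X.
Proof.
move=> uX; rewrite inE => cn.
apply: (@connect_preserves _ (avoiding X) (fun a => a \notin X) u) => // a b _.
by case/and3P.
Qed.

Lemma component_step X u a b :
  a \in component X u -> avoiding X a b -> b \in component X u.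
Proof.
by move=> ua ab; move: ua; rewrite !inE => /connect_trans; apply; apply: connect1.
Qed.

Lemma component_eq X u a : a \in component X u -> component X a = component X u.
Proof.
rewrite inE => ua; apply/setP => b; rewrite !inE.
by rewrite (same_connect (sym_connect_sym (avoiding_sym X)) ua).
Qed.

(** Let [i] be the last position before [n] where [u i] is adjacent to [x].  If it
were not [n.-1], then [x], [u i], ..., [u n] would be a chordless cycle of length
at least four. *)
Lemma adj_penultimate (u : nat -> H) n x : chordal H ->
  (forall i, i < n -> adj (u i) (u i.+1)) ->
  (forall i j, i < j <= n -> u i != u j) ->
  (forall i j, i < j <= n -> adj (u i) (u j) -> j = i.+1) ->
  (forall i, i <= n -> u i != x) -> 0 < n ->
  adj (u 0) x -> adj (u n) x -> adj (u n.-1) x.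
Proof.
move=> chH stp inj ind xu n_gt0 u0x unx; apply: contraT => nmx.
have P0 : exists i, (i < n) && adj (u i) x by exists 0; rewrite n_gt0.
have P_le i : (i < n) && adj (u i) x -> i <= n by case/andP=> /ltnW.
case: (ex_maxnP P0 P_le) => i /andP[i_lt uix] i_max {P0 P_le}.
have i_lt1 : i.+1 < n.
  have i_neq : i != n.-1 by apply: contraNneq nmx => <-.
  by move: i_lt i_neq n_gt0; clear; lia.
pose c := x :: mkseq (fun j => u (i + j)) (n - i).+1.
have c_nth j : j <= n - i -> nth x c j.+1 = u (i + j).
  move=> j_le; rewrite /c /=.
  by rewrite -[RHS](@nth_mkseq _ x (fun j => u (i + j)) (n - i).+1).
have size_c : size c = (n - i).+2 by rewrite /= size_map size_iota.
have cyc_c : ucycle (@adj H) c.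
  apply/andP; split.
    rewrite /c /cycle rcons_path; apply/andP; split; last first.
      rewrite -[last _ _]nth_last size_mkseq nth_mkseq //.
      by rewrite subnKC // ltnW.
    apply/(pathP x) => -[|j]; rewrite size_mkseq ltnS => j_le.
      by rewrite /= addn0 adj_sym.
    have := c_nth j (ltnW j_le); rewrite /c => ->.
    rewrite nth_mkseq // addnS; apply: stp.
    by move: j_le; clear; lia.
  rewrite /c cons_uniq; apply/andP; split.
    apply/negP => /mapP[j]; rewrite mem_iota => j_lt xE.
    have /eqP[] := xu (i + j) ltac:(move: j_lt i_lt; clear; lia).
    by [].
  rewrite map_inj_in_uniq ?iota_uniq // => j k; rewrite !mem_iota => j_lt k_lt.
  have [jk|kj|//] := ltngtP j k; move=> ujk.
    have ijk : i + j < i + k <= n by move: jk j_lt k_lt i_lt; clear; lia.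
    by have /eqP := inj _ _ ijk.
  have ikj : i + k < i + j <= n by move: kj j_lt k_lt i_lt; clear; lia.
  by have := inj _ _ ikj; rewrite eq_sym => /eqP.
have := chH c cyc_c; rewrite size_c => chord.
have [|a [b [ac bc ab nab nba]]] := chord; first by move: i_lt1; clear; lia.
case: (@chord_of_induced _ _ x c a b (@adj_sym H) (@adj_irrefl H) _ ac bc ab).
- move=> k [//|l]; rewrite size_c ltnS => /andP[kl l_lt].
  rewrite c_nth; last by rewrite -ltnS.
  case: k kl => [|k] kl.
    rewrite /= adj_sym => aux.
    have [l_lt'|l_ge] := ltnP (i + l) n; last first.
      by right; split=> //; move: l_lt l_ge; clear; lia.
    have := i_max (i + l); rewrite l_lt' aux => /(_ isT) il_le.
    by left; move: il_le; clear; lia.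
  rewrite c_nth; last by move: kl l_lt; clear; lia.
  move/ind => il; left; have := il ltac:(move: kl l_lt i_lt; clear; lia).
  by clear; lia.
- by move=> bE; rewrite bE eqxx in nab.
- by move=> aE; rewrite aE eqxx in nba.
Qed.

(** Some vertex [v] of a component of the complement of a clique [X] is adjacent
to all the vertices of [X] that the component touches: take [v] with the most
neighbours in [X].  If [v] misses a touched [y], the penultimate vertex of an
induced path from [v] to [y] through the component is adjacent to [y] and, by
[adj_penultimate], to all the neighbours of [v] in [X]: it beats [v]. *)
Lemma attachment_vertex X u : chordal H -> is_clique X -> u \notin X ->
  exists2 v, v \in component X u &
    forall y z, y \in X -> z \in component X u -> adj z y -> adj v y.
Proof.
move=> chH clX uX; set K := component X u.
have uK : u \in K by rewrite inE connect0.
have KX a : a \in K -> a \notin X by apply: component_notin.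
have [v vK v_max] := @arg_maxnP _ u (mem K) (fun v => #|[set y in X | adj v y]|) uK.
have {}vK : v \in K := vK.
exists v => // y z yX zK zy; apply: contraT => nvy.
(* Edges of [r] must leave from [K]: a path to [y] has all its vertices in [K]
   except the last. *)
pose r := [rel a b : H | (a \in K) && adj a b].
have vz : connect r v z.
  have P_step a b : (a \in K) && connect r v a -> avoiding X a b ->
      (b \in K) && connect r v b.
    move=> /andP[aK va] ab; rewrite (component_step aK ab) /=.
    by apply: connect_trans va (connect1 _); rewrite /= aK; case/and3P: ab.
  have : connect (avoiding X) v z by move: zK; rewrite /K -(component_eq vK) inE.
  by move/(connect_preserves P_step); rewrite vK connect0 => /(_ isT)/andP[].
have {vz} vy : connect r v y.
  by apply: connect_trans vz (connect1 _); rewrite /= zK.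
have [s [/(pathP v) pth lst uq ind]] := induced_path vy.
set n := size s in pth ind *; pose u_ i := nth v (v :: s) i.
have {}pth i : i < n -> (u_ i \in K) && adj (u_ i) (u_ i.+1) by move/pth.
have un : u_ n = y by rewrite -lst (last_nth v).
have {}ind i j : i < j <= n -> adj (u_ i) (u_ j) -> j = i.+1.
  move=> lt_ij; case/andP: (lt_ij) => i_lt j_le; move=> aij; apply: ind => //=.
  by rewrite aij andbT; case/andP: (pth i (leq_trans i_lt j_le)).
have n_gt1 : 1 < n.
  rewrite ltnNge; apply/negP; rewrite leq_eqVlt => /orP[/eqP n1|].
    by have := pth 0; rewrite n1 => /(_ isT) /andP[_]; rewrite -n1 un (negPf nvy).
  by rewrite ltnS leqn0 => /eqP n0; move: (KX v vK); rewrite -[v]/(u_ 0) -n0 un yX.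
have /andP[mK my] := pth n.-1 ltac:(lia).
rewrite (ltn_predK n_gt1) un in my.
suff sub x : x \in X -> adj v x -> adj (u_ n.-1) x.
  have : #|[set x in X | adj (u_ n.-1) x]| <= #|[set x in X | adj v x]|.
    exact: v_max.
  rewrite leqNgt => /negP[]; apply: proper_card.
  apply/properP; split.
    by apply/subsetP => x; rewrite !inE => /andP[xX /(sub x xX) ->]; rewrite xX.
  by exists y; rewrite !inE yX ?my.
move=> xX vx; apply: (@adj_penultimate u_ n) => //.
- by move=> i /pth/andP[].
- move=> i j /andP[ij j_le].
  have j_lt : j < size (v :: s) by [].
  by rewrite /u_ nth_uniq ?(ltn_trans ij) // neq_ltn ij.
- move=> i; rewrite leq_eqVlt => /orP[/eqP->|/pth/andP[/KX uX' _]].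
    by rewrite un; apply: contraNneq nvy => ->.
  by apply: contraNneq uX' => ->.
- exact: ltnW.
- by rewrite un clX // ; apply: contraNneq nvy => ->.
Qed.

(** Descent: as long as a component [K] of the complement of [X] contains more
than half of [S], replace [X] by the vertices of [X] that [K] touches and an
attachment vertex [v] of [K].  A new component with more than half of [S] meets
[K], cannot leave it, and avoids [v], so it is smaller than [K]. *)
Lemma balanced_clique S : chordal H -> exists2 X, is_clique X &
  forall u, u \notin X -> 2 * #|S :&: component X u| <= #|S|.
Proof.
move=> chH.
pose heavy X u := (u \notin X) && (#|S| < 2 * #|S :&: component X u|).
have light X : ~~ [exists u, heavy X u] ->
    forall u, u \notin X -> 2 * #|S :&: component X u| <= #|S|.
  move=> /existsPn Xl u uX; have := Xl u; rewrite /heavy uX /=; lia.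
suff descend n X u : is_clique X -> heavy X u -> #|component X u| <= n ->
    exists2 X', is_clique X' &
      forall u, u \notin X' -> 2 * #|S :&: component X' u| <= #|S|.
  have cl0 : is_clique (set0 : {set H}) by move=> a b; rewrite inE.
  have [/existsP[u u_heavy]|/light] := boolP [exists u, heavy set0 u].
    exact: descend cl0 u_heavy (leqnn _).
  by exists set0.
elim: n X u => [|n IHn] X u clX /andP[uX u_heavy] le_n.
  move: le_n; rewrite leqn0 cards_eq0 => /eqP K0.
  by move: u_heavy; rewrite K0 setI0 cards0 muln0.
set K := component X u in u_heavy le_n.
have [v vK v_att] := attachment_vertex chH clX uX.
pose X' := v |: [set y in X | [exists z in K, adj z y]].
have X'P y : y \in X' -> y = v \/ y \in X /\ exists2 z, z \in K & adj z y.
  rewrite !inE => /orP[/eqP|/andP[yX /existsP[z /andP[zK zy]]]]; first by left.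
  by right; split=> //; exists z.
have clX' : is_clique X'.
  move=> a b /X'P[->|[aX [z zK za]]] /X'P[->|[bX [z' z'K z'b]]] ab.
  - by rewrite eqxx in ab.
  - exact: v_att z'K z'b.
  - by rewrite adj_sym; apply: v_att zK za.
  - exact: clX.
have [/existsP[u' /andP[u'X' u'_heavy]]|/light] := boolP [exists u, heavy X' u];
  last by exists X'.
apply: (IHn X' u') => //; first by rewrite /heavy u'X'.
(* Two sets that each contain more than half of [S] intersect. *)
have [w wK wK'] : exists2 w, w \in K & w \in component X' u'.
  apply/exists_inP; apply: contraT => /exists_inPn K_dis.
  have : #|S :&: K| + #|S :&: component X' u'| <= #|S|.
    rewrite -cardsUI -[X in _ <= X]addn0; apply: leq_add.
      by rewrite -setIUr subset_leq_card ?subsetIl.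
    rewrite leqn0 cards_eq0; apply/eqP/setP => a; rewrite [RHS]inE.
    by apply/negP; rewrite !in_setI => /and3P[/andP[_ /K_dis/negP]].
  move: u_heavy u'_heavy; clear; lia.
rewrite -(component_eq wK') -ltnS; apply: leq_trans le_n; apply: proper_card.
apply/properP; split; last first.
  exists v => //; apply/negP; rewrite (component_eq wK') => /(component_notin u'X').
  by rewrite !inE eqxx.
apply/subsetP => b; rewrite inE => wb.
apply: (@connect_preserves _ (avoiding X') (mem K) w) => // a c /= aK.
case/and3P=> ac _ cX'.
apply: (component_step aK); rewrite /avoiding /= ac (component_notin uX aK) /=.
apply: contra cX' => cX; rewrite !inE cX; apply/orP; right.
by apply/existsP; exists a; apply/andP.
Qed.

(** Group the components of the complement of a balanced clique: among the unions
[A] of components that contain at most two thirds of [S], take one with the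
largest share.  If the other side [B] had more than two thirds, add to [A] a
component [K] within [B] meeting [S].  By maximality [A] and [K] together have
more than two thirds and [K] alone has at most as much as [A]; so [A] has more
than one third, against the share of [B]. *)
Lemma balanced_separation S : chordal H -> exists X A : {set H},
  [/\ is_clique X, [disjoint A & X],
      forall a b, a \in A -> adj a b -> b \in A :|: X,
      3 * #|S :&: A| <= 2 * #|S| & 3 * #|S :\: (A :|: X)| <= 2 * #|S|].
Proof.
move=> chH; have [X clX X_bal] := balanced_clique S chH.
pose side A := [&& [disjoint A & X],
  [forall a in A, forall b, adj a b ==> (b \in A :|: X)]
  & 3 * #|S :&: A| <= 2 * #|S|].
have sideP A : reflect [/\ [disjoint A & X],
    forall a b, a \in A -> adj a b -> b \in A :|: X
    & 3 * #|S :&: A| <= 2 * #|S|] (side A).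
  apply: (iffP and3P) => -[dAX cl bal]; split=> //.
    by move=> a b aA; move/forall_inP: cl => /(_ a aA)/forallP/(_ b)/implyP.
  by apply/forall_inP => a aA; apply/forallP => b; apply/implyP; apply: cl.
have side0 : side set0.
  apply/sideP; split=> [|a b|]; last by rewrite setI0 cards0.
    by rewrite -setI_eq0 set0I.
  by rewrite inE.
have [A /sideP[dAX A_cl A_le] A_max] :=
  @arg_maxnP _ set0 side (fun A => #|S :&: A|) side0.
exists X, A; split=> //; rewrite leqNgt; apply/negP => B_gt.
have S_split : #|S :&: A| + #|S :\: (A :|: X)| <= #|S|.
  rewrite -cardsUI [X in _ + X](_ : _ = 0) ?addn0.
    by apply: subset_leq_card; rewrite subUset subsetIl subsetDl.
  apply/eqP; rewrite cards_eq0 -subset0; apply/subsetP => a; rewrite !inE.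
  by case: (a \in A); rewrite ?andbF.
have [u uB] : exists u, u \in S :\: (A :|: X).
  by apply/set0Pn; rewrite -card_gt0; move: B_gt; clear; lia.
move: uB; rewrite !inE negb_or => /andP[/andP[uA uX] uS].
set K := component X u.
have dKX : [disjoint K & X].
  by apply/pred0P => a /=; apply/negP => /andP[/(component_notin uX)/negP].
have K_cl a b : a \in K -> adj a b -> b \in K :|: X.
  move=> aK ab; rewrite inE; case: (boolP (b \in X)) => [_|bX]; rewrite ?orbT //.
  by rewrite (component_step aK) // /avoiding /= ab bX (component_notin uX aK).
have K_le := X_bal u uX; rewrite -/K in K_le.
have dAK : #|S :&: (A :|: K)| = #|S :&: A| + #|S :&: K|.
  rewrite setIUr -cardsUI [X in _ + X](_ : _ = 0) ?addn0 //.
  apply/eqP; rewrite cards_eq0 -subset0; apply/subsetP => a.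
  rewrite !in_setI => /andP[/andP[_ aA] /andP[_ aK]].
  have : a \notin A; last by rewrite aA.
  apply: (@connect_preserves _ (avoiding X) (fun a => a \notin A) u) => //.
    move=> c d cA /and3P[cd cX dX]; apply: contra cA => dA.
    have := A_cl d c dA; rewrite adj_sym => /(_ cd).
    by rewrite inE (negPf cX) orbF.
  by move: aK; rewrite inE.
have SK_gt0 : 0 < #|S :&: K|.
  by rewrite card_gt0; apply/set0Pn; exists u; rewrite !inE uS connect0.
have /A_max : side K.
  by apply/sideP; split=> //; move: K_le; clear; lia.
have AK_gt : ~~ (3 * #|S :&: (A :|: K)| <= 2 * #|S|).
  apply/negP => AK_le; have /A_max : side (A :|: K).
    apply/sideP; split=> //.
      by rewrite -setI_eq0 setIUl !disjoint_setI0 ?setU0.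
    move=> a b; rewrite in_setU => /orP[/A_cl|/K_cl] cl /cl; rewrite !inE.
      by case/orP=> ->; rewrite ?orbT.
    by case/orP=> ->; rewrite ?orbT.
  by rewrite dAK; move: SK_gt0; clear; lia.
rewrite dAK in AK_gt; move: B_gt S_split AK_gt; clear; lia.
Qed.

End Separators.

(** * Separators in graphs of bounded treewidth *)

Lemma treewidth_clique (H : sgraph) k :
  (forall A : {set H}, is_clique A -> #|A| <> k + 2) ->
  forall A : {set H}, is_clique A -> #|A| <= k.+1.
Proof.
move=> no_cl A clA; rewrite leqNgt; apply/negP => A_gt.
pose s := take (k + 2) (enum A).
have s_size : size s = k + 2 by rewrite size_takel // -cardE addn2.
have sA x : x \in s -> x \in A by move/mem_take; rewrite mem_enum.
apply: (no_cl [set x in s]).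
  by move=> x y; rewrite !inE => /sA xA /sA yA; apply: clA.
by rewrite cardsE (card_uniqP _) // take_uniq // enum_uniq.
Qed.

(** A separation of the chordal supergraph is pulled back along the embedding;
the shares of [S] are kept because the embedding is injective. *)
Lemma treewidth_separation (G : sgraph) k (S : {set G}) : treewidth_le G k ->
  exists X A : {set G}, [/\ #|X| <= k.+1, [disjoint A & X],
    forall a b, a \in A -> adj a b -> b \in A :|: X,
    3 * #|S :&: A| <= 2 * #|S| & 3 * #|S :\: (A :|: X)| <= 2 * #|S|].
Proof.
case=> H [[h h_inj h_adj] chH no_cl].
have [X [A [clX dAX A_cl A_le B_le]]] := balanced_separation (h @: S) chH.
have pre_card (P : {set H}) (Q : {set G}) :
    (forall x, x \in Q -> h x \in P) -> #|Q| <= #|P|.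
  move=> QP; rewrite -(card_imset _ h_inj); apply: subset_leq_card.
  by apply/subsetP => _ /imsetP[x /QP hx ->].
exists (h @^-1: X), (h @^-1: A); split.
- apply: leq_trans (treewidth_clique no_cl clX); apply: pre_card => x.
  by rewrite inE.
- rewrite -setI_eq0; apply/eqP/setP => x; rewrite !inE; apply/negP => /andP[xA xX].
  by move: (disjointFr dAX xA); rewrite xX.
- by move=> a b; rewrite !inE => aA /h_adj/(A_cl _ _ aA); rewrite inE.
- rewrite -[#|S|](card_imset _ h_inj); apply: leq_trans A_le.
  rewrite leq_mul2l; apply: pre_card => x; rewrite !inE => /andP[xS ->].
  by rewrite imset_f.
- rewrite -[#|S|](card_imset _ h_inj); apply: leq_trans B_le.
  rewrite leq_mul2l; apply: pre_card => x; rewrite !inE => /andP[-> xS].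
  by rewrite imset_f.
Qed.

(** * Tree-partitions with small bags *)

Section Layerings.
Variable G : sgraph.
Implicit Types (U S : {set G}) (dep : G -> nat).

Definition below U dep n : rel G :=
  [rel x y | [&& adj x y, x \in U, y \in U, n <= dep x & n <= dep y]].

(** A tree-partition is encoded by the depth function of its bags alone: the bag
of [x] consists of the vertices at the depth of [x] that can be reached from [x]
without passing through a smaller depth. *)
Definition bag U dep (x : G) : {set G} :=
  [set y | (dep y == dep x) && connect (below U dep (dep x)) x y].

Definition layering U dep l :=
  {in U &, forall x y, adj x y -> dep x <= (dep y).+1} /\
  {in U, forall x, #|bag U dep x| <= l}.

(** All the vertices of depth 0, which [bag] may divide further, are counted as
one bag: this is the quantity that adds up when two tree-partitions are glued. *)
Definition root_bag U dep : {set G} := [set x in U | dep x == 0].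

Lemma bag_root U dep x : x \in U -> dep x = 0 -> bag U dep x \subset root_bag U dep.
Proof.
move=> xU dx; apply/subsetP => y; rewrite !inE dx => /andP[-> cn]; rewrite andbT.
by apply: (connect_preserves _ cn xU) => a b _ /and5P[].
Qed.

(** The common form of all comparisons of bags below: every walk that defines the
bag of [x] in [U] stays in [P], and there it is also a walk for [U']. *)
Lemma bag_transfer U dep U' dep' (P : pred G) x : P x ->
  (forall a b, P a -> below U dep (dep x) a b ->
     P b && below U' dep' (dep' x) a b) ->
  (forall a, P a -> dep a = dep x -> dep' a = dep' x) ->
  #|bag U dep x| <= #|bag U' dep' x|.
Proof.
move=> Px P_step P_dep; apply/subset_leq_card/subsetP => y.
rewrite !inE => /andP[/eqP dy cn].
have : P y && connect (below U' dep' (dep' x)) x y.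
  apply: (@connect_preserves _ _
            (fun b => P b && connect (below U' dep' (dep' x)) x b) x y _ cn)
    => [a b /andP[Pa xa] ab|]; last by rewrite Px connect0.
  have /andP[-> ab'] := P_step a b Pa ab.
  exact: connect_trans xa (connect1 ab').
by case/andP=> Py ->; rewrite (P_dep _ Py dy) eqxx.
Qed.

Lemma eq_layering U dep dep' l :
  {in U, dep =1 dep'} -> layering U dep' l -> layering U dep l.
Proof.
move=> eq_dep [dep_adj dep_bag]; split=> [x y xU yU|x xU].
  by rewrite !eq_dep //; apply: dep_adj.
apply: leq_trans (dep_bag x xU); apply: (@bag_transfer _ _ _ _ (mem U)) => //=.
  by move=> a b aU /and5P[ab _ bU]; rewrite /below /= !eq_dep // aU bU ab => -> ->.
by move=> a aU; rewrite !eq_dep.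
Qed.

(** At positive depth a walk cannot cross between [U1] and [U2], whose common
vertices have depth 0; so only the root bag grows. *)
Lemma glue_layering U1 U2 dep l : layering U1 dep l -> layering U2 dep l ->
  {in U1 :&: U2, forall x, dep x = 0} ->
  (forall x y, x \in U1 -> y \in U2 -> adj x y -> (x \in U2) || (y \in U1)) ->
  #|root_bag U1 dep :|: root_bag U2 dep| <= l ->
  layering (U1 :|: U2) dep l.
Proof.
move=> [adj1 bag1] [adj2 bag2] dep0 cross root_le.
have cross' x y : x \in U2 -> y \in U1 -> adj x y -> (x \in U1) || (y \in U2).
  by rewrite adj_sym orbC => xU yU yx; apply: cross.
have stay V1 V2 a b d : {in V1 :&: V2, forall x, dep x = 0} ->
    (forall x y, x \in V1 -> y \in V2 -> adj x y -> (x \in V2) || (y \in V1)) ->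
    0 < d -> a \in V1 -> below (V1 :|: V2) dep d a b ->
    (b \in V1) && below V1 dep d a b.
  move=> V0 Vc d_gt0 aV /and5P[ab _ bV da db].
  rewrite /below /= ab aV da db !andbT andbb.
  move: bV; rewrite in_setU => /orP[//|bV]; have /orP[aV2|//] := Vc a b aV bV ab.
  by move: da; rewrite V0 ?inE ?aV // leqNgt d_gt0.
split=> [x y|x xU].
  rewrite !in_setU => /orP[]xU /orP[]yU xy; [exact: adj1| | |exact: adj2].
    have /orP[xU2|yU1] := cross x y xU yU xy; [exact: adj2|exact: adj1].
  have /orP[xU1|yU2] := cross' x y xU yU xy; [exact: adj1|exact: adj2].
have [dx|dx_gt0] := posnP (dep x).
  apply: leq_trans (subset_leq_card (bag_root xU dx)) _; apply: leq_trans root_le.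
  by apply/subset_leq_card/subsetP => y; rewrite !inE andb_orl.
move: xU; rewrite in_setU => /orP[]xU.
  apply: leq_trans (bag1 x xU); apply: (@bag_transfer _ _ _ _ (mem U1)) => //.
  by move=> a b aU; apply: stay.
apply: leq_trans (bag2 x xU); apply: (@bag_transfer _ _ _ _ (mem U2)) => //.
by move=> a b aU; rewrite setUC; apply: stay; rewrite // setIC.
Qed.

Variables (w D : nat).
Hypothesis w_gt0 : 0 < w.
Hypothesis D_gt0 : 0 < D.
Hypothesis deg_le : forall x : G, degree x <= D.
Hypothesis sep : forall S : {set G},
  exists X A : {set G}, [/\ #|X| <= w, [disjoint A & X],
    forall a b, a \in A -> adj a b -> b \in A :|: X,
    3 * #|S :&: A| <= 2 * #|S| & 3 * #|S :\: (A :|: X)| <= 2 * #|S|].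

(** The bound on the root bag is [2 * s - 4 * w], where [s] is the larger of
[#|S|] and [4 * w].  When [S] is split by [w] vertices that both sides receive,
the sizes of the two prescribed sets add up to at most [#|S| + 2 * w]; the
constant [4 * w] is subtracted once on each side and so absorbs this surplus. *)
Definition rooted U S dep :=
  [/\ layering U dep (24 * w * D), {in S, forall x, dep x = 0} &
      #|root_bag U dep| + 4 * w <= 2 * maxn #|S| (4 * w)].

Lemma card_neighbours S (T : {set G}) :
  (forall y, y \in T -> exists2 x, x \in S & adj x y) -> #|T| <= #|S| * D.
Proof.
move=> T_nb; apply: (@leq_trans #|\bigcup_(x in S) [set y | adj x y]|).
  apply/subset_leq_card/subsetP => y /T_nb[x xS xy].
  by apply/bigcupP; exists x; rewrite ?inE.
apply: (@leq_trans (\sum_(x in S) #|[set y | adj x y]|)).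
  elim/big_rec2: _ => [|x m A _ IH]; first by rewrite cards0.
  by apply: leq_trans (leq_card_setU _ _) _; rewrite leq_add2l.
by rewrite -sum_nat_const; apply: leq_sum => x _; apply: deg_le.
Qed.

(** The vertices of [S] become a new root bag on top of a tree-partition whose
root bag contains all their neighbours. *)
Lemma add_root_bag U S S' dep : S \subset U -> #|S| <= 12 * w ->
  (forall x y, x \in S -> y \in U :\: S -> adj x y -> y \in S') ->
  layering (U :\: S) dep (24 * w * D) -> {in S', forall x, dep x = 0} ->
  rooted U S (fun x => if x \in S then 0 else (dep x).+1).
Proof.
move=> SU S_le S'_nb [dep_adj dep_bag] S'0; set dep1 := fun x => _.
have root_sub : root_bag U dep1 \subset S.
  by apply/subsetP => x; rewrite inE /dep1; case: ifP => //; rewrite andbF.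
have root_le := subset_leq_card root_sub.
split.
- split=> [x y xU yU xy|x xU].
    rewrite /dep1; case: ifP => // xS; case: ifP => yS.
      by rewrite (S'0 x) // (S'_nb y) // ?inE ?xS // adj_sym.
    by rewrite ltnS dep_adj // inE ?xS ?yS.
  have [xS|xS] := boolP (x \in S).
    have dx : dep1 x = 0 by rewrite /dep1 xS.
    apply: leq_trans (subset_leq_card (bag_root xU dx)) _.
    by apply: leq_trans root_le _; move: S_le D_gt0; clear; nia.
  apply: leq_trans (dep_bag x _); last by rewrite inE xS.
  apply: (@bag_transfer _ _ _ _ (fun y => y \notin S)) => // [a b aS|a aS].
    rewrite /below /= /dep1 (negPf xS) (negPf aS) => /and5P[ab aU bU da].
    case: ifP => // bS; rewrite ltnS => db.
    by rewrite ab db -ltnS da !inE aS bS aU bU.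
  by rewrite /dep1 (negPf aS) (negPf xS) => -[].
- by move=> x xS; rewrite /dep1 xS.
- by move: root_le S_le; clear; lia.
Qed.

Lemma rooted0 U S : U = set0 -> S \subset U -> rooted U S (fun=> 0).
Proof.
move=> ->; rewrite subset0 => /eqP ->; split; first by split=> [x y|x]; rewrite inE.
  by move=> x; rewrite inE.
rewrite (_ : root_bag _ _ = set0); last by apply/setP => x; rewrite !inE.
by rewrite !cards0; lia.
Qed.

(** Up to [12 * w] prescribed vertices can be taken as the root bag itself: they
have at most [12 * w * D] neighbours, which are prescribed next.  More than
[12 * w] vertices are split; as each side keeps at least [#|S| %/ 3 - w > 0] of
them, both sides are smaller than [U].  The share of a side plus [w] is at least
[#|S| %/ 3 >= 4 * w], so it also bounds the maximum in [rooted] for that side. *)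
Lemma exists_layering n U S : #|U| <= n -> S \subset U -> #|S| <= 12 * w * D ->
  exists dep, rooted U S dep.
Proof.
elim: n U S => [|n IHn] U S U_le SU S_le; have [U0|[u uU]] := set_0Vmem U.
- by exists (fun=> 0); apply: rooted0 SU.
- by move: U_le; rewrite leqn0 cards_eq0 => /eqP U0; rewrite U0 inE in uU.
- by exists (fun=> 0); apply: rooted0 SU.
have [S_small|S_large] := leqP #|S| (12 * w).
  (* If nothing is prescribed, any vertex serves as the root bag. *)
  pose S0 := if S == set0 then [set u] else S.
  have S0U : S0 \subset U by rewrite /S0; case: ifP; rewrite ?sub1set.
  have S0_le : #|S0| <= maxn #|S| 1.
    by rewrite /S0; case: ifP; rewrite ?cards1 ?leq_maxl ?leq_maxr.
  have S0_gt : 0 < #|S0|.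
    by rewrite /S0; case: ifP => [|/negbT]; rewrite ?cards1 ?card_gt0.
  pose S' := [set y in U :\: S0 | [exists x in S0, adj x y]].
  have [|||dep [dep_lay dep0 _]] := IHn (U :\: S0) S'.
  - have := cardsID S0 U; rewrite (setIidPr S0U); move: U_le S0_gt; clear; lia.
  - by apply/subsetP => x; rewrite inE => /andP[].
  - apply: leq_trans (@card_neighbours S0 S' _) _.
      by move=> y; rewrite inE => /andP[_ /exists_inP].
    by rewrite leq_mul2r; move: S0_le S_small w_gt0; clear; lia.
  have [|||||S_root S0_0 root_le] := @add_root_bag U S0 S' dep.
  - done.
  - by move: S0_le S_small w_gt0; clear; lia.
  - by move=> x y xS0 yU xy; rewrite inE yU; apply/exists_inP; exists x.
  - done.
  - done.
  eexists; split; first exact: S_root.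
    move=> x xS; apply: S0_0; rewrite /S0; case: ifP => // /eqP S_0.
    by rewrite S_0 inE in xS.
  apply: leq_trans root_le _; move: S0_le w_gt0; clear; lia.
have [X [A [X_le dAX A_cl A_le B_le]]] := sep S.
pose B := ~: (A :|: X).
have BE : S :\: (A :|: X) = S :&: B by rewrite setDE.
rewrite BE in B_le.
have S_split : #|S| = #|S :&: A| + #|S :&: B| + #|S :&: X|.
  have -> : S :&: B = S :\: A :\: X.
    by rewrite -BE setDDl.
  have -> : S :&: X = (S :\: A) :&: X.
    apply/setP => x; rewrite !inE; have [xX|] := boolP (x \in X); rewrite ?andbF //.
    by rewrite (disjointFl dAX xX).
  by have := cardsID A S; have := cardsID X (S :\: A); lia.
have SX_le : #|S :&: X| <= #|U :&: X| by apply/subset_leq_card/setSI.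
have UX_le : #|U :&: X| <= w.
  by apply: leq_trans X_le; apply/subset_leq_card/subsetIr.
have half (V W : {set G}) :
    V \subset U -> 0 < #|S :&: W| -> [disjoint V & W] -> #|V| <= n.
  move=> VU; rewrite card_gt0 => /set0Pn[x]; rewrite inE => /andP[xS xW] dVW.
  rewrite -ltnS; apply: (leq_trans _ U_le); apply: proper_card.
  apply/properP; split=> //.
  by exists x; [apply: (subsetP SU)|rewrite (disjointFl dVW xW)].
pose U1 := U :&: (A :|: X); pose U2 := U :\: A.
pose S1 := (S :&: A) :|: (U :&: X); pose S2 := (S :&: B) :|: (U :&: X).
have S1_le : #|S1| <= #|S :&: A| + #|U :&: X| by apply: leq_card_setU.
have S2_le : #|S2| <= #|S :&: B| + #|U :&: X| by apply: leq_card_setU.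
have [|||dep1 [lay1 dep1_0 root1]] := IHn U1 S1.
- apply: (half _ B); rewrite ?subsetIl //.
    by move: S_split A_le SX_le UX_le S_large; clear; lia.
  by rewrite -setI_eq0 /U1 /B -setIA setICr setI0.
- rewrite subUset setISS //= ?subsetUl //.
    by rewrite setIS ?subsetUr.
- by move: S1_le A_le UX_le S_large S_le; clear; lia.
have [|||dep2 [lay2 dep2_0 root2]] := IHn U2 S2.
- apply: (half _ A); rewrite ?subsetDl //.
    by move: S_split B_le SX_le UX_le S_large; clear; lia.
  by rewrite -setI_eq0 /U2 setDE -setIA [~: A :&: A]setIC setICr setI0.
- rewrite subUset; apply/andP; split; apply/subsetP => x; rewrite !inE.
    by rewrite negb_or => /andP[/(subsetP SU) -> /andP[->]].
  by case/andP=> -> xX; rewrite (disjointFl dAX xX).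
- by move: S2_le B_le UX_le S_large S_le; clear; lia.
pose dep x := if x \in A then dep1 x else dep2 x.
have depX x : x \in U -> x \in X -> dep1 x = 0 /\ dep2 x = 0.
  move=> xU xX; have xUX : x \in U :&: X by rewrite inE xU.
  by split; [apply: dep1_0|apply: dep2_0]; apply: (subsetP (subsetUr _ _)) xUX.
have dep1E : {in U1, dep =1 dep1}.
  move=> x; rewrite !inE /dep => /andP[xU]; case: ifP => //= _ xX.
  by have [-> ->] := depX x xU xX.
have dep2E : {in U2, dep =1 dep2}.
  by move=> x; rewrite !inE /dep => /andP[/negPf->].
have rootE (V : {set G}) dep' :
    {in V, dep =1 dep'} -> root_bag V dep = root_bag V dep'.
  by move=> eq_dep; apply/setP => x; rewrite !inE; apply: andb_id2l => /eq_dep ->.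
have root_le : #|root_bag U1 dep :|: root_bag U2 dep| + 4 * w <= 2 * #|S|.
  apply: (@leq_trans (#|root_bag U1 dep| + #|root_bag U2 dep| + 4 * w)).
    by rewrite leq_add2r leq_card_setU.
  rewrite (rootE _ _ dep1E) (rootE _ _ dep2E).
  move: root1 root2 S1_le S2_le A_le B_le S_split SX_le UX_le S_large; clear; lia.
have UE : U = U1 :|: U2.
  apply/setP => x; rewrite !inE; case: (x \in U); rewrite ?andbF //= andbT.
  by case: (x \in A); rewrite ?orbT.
exists dep; split.
- rewrite UE; apply: glue_layering.
  + exact: eq_layering lay1.
  + exact: eq_layering lay2.
  + move=> x; rewrite !inE /dep => /andP[/andP[xU xAX] /andP[xA _]].
    rewrite (negPf xA) in xAX *.
    by have [_ ->] := depX x xU xAX.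
  + move=> x y; rewrite !inE => /andP[xU xAX] /andP[yA yU] xy.
    rewrite xU yU (negPf yA) andbT /=.
    have [xA|//] := boolP (x \in A).
    by have := A_cl x y xA xy; rewrite inE (negPf yA).
  + by move: root_le S_le; clear; lia.
- move=> x xS; have xU := subsetP SU x xS; rewrite /dep.
  have [xA|xA] := boolP (x \in A).
    by rewrite dep1_0 // !inE xS xA.
  by rewrite dep2_0 // !inE xS (negPf xA) xU /=; case: (x \in X).
- rewrite UE (_ : root_bag _ _ = root_bag U1 dep :|: root_bag U2 dep).
    by apply: leq_trans root_le _; rewrite leq_mul2l leq_maxl.
  by apply/setP => x; rewrite !inE andb_orl.
Qed.
End Layerings.

(** * Colourings from a tree-partition *)

Lemma greedy_colouring (T : finType) (r : rel T) d : symmetric r ->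
  (forall x, #|[set y | r x y]| <= d) ->
  exists f : T -> 'I_d.+1, forall x y, r x y -> x != y -> f x != f y.
Proof.
move=> r_sym r_le.
suff [f fP] : exists f : T -> 'I_d.+1,
    {in enum T &, forall x y, r x y -> x != y -> f x != f y}.
  by exists f => x y; apply: fP; rewrite mem_enum.
(* The vertices are coloured from the last of the list to the first: a colour
   unused on the neighbours of the head is always left. *)
elim: (enum T) => [|x s [f fP]]; first by exists (fun=> ord0) => x y.
have [c cP] : exists c, c \notin f @: [set y | r x y].
  apply/existsP; apply: contraT => /existsPn all_used.
  have := leq_trans (leq_imset_card f _) (r_le x).
  rewrite (_ : f @: _ = setT) ?cardsT ?card_ord ?ltnn //.
  by apply/setP => c; rewrite in_setT; apply/negPn/all_used.
have c_new y : r x y -> f y != c.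
  by move=> xy; apply: contraNneq cP => <-; apply: imset_f; rewrite inE.
exists (fun y => if y == x then c else f y) => y z; rewrite !inE.
have [->|yx] := eqVneq y x; have [->|zx] := eqVneq z x => //=.
- by move=> _ _ /c_new; rewrite eq_sym.
- by move=> _ _; rewrite r_sym => /c_new.
- by move=> ys zs; apply: fP.
Qed.

Section Colouring.
Variable G : sgraph.

Lemma walk_stepP (t : nat) (w : (t + t).-tuple G) x0 i :
  is_walk w -> i.+1 < t + t -> adj (nth x0 w i) (nth x0 w i.+1).
Proof.
by move=> /(sortedP x0) wP i_lt; apply: wP; rewrite size_tuple.
Qed.

Lemma tnth_halves (t : nat) (w : (t + t).-tuple G) x0 (i : 'I_t) :
  tnth w (lshift t i) = nth x0 w i /\ tnth w (rshift t i) = nth x0 w (t + i).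
Proof. by rewrite !(tnth_nth x0). Qed.

Lemma path_colourable_fin (C : finType) (f : G -> C) :
  (forall t (w : (t + t).-tuple G), 0 < t -> is_path w ->
    ~ forall i : 'I_t, f (tnth w (lshift t i)) = f (tnth w (rshift t i))) ->
  path_colourable G #|C|.
Proof.
move=> fP; exists (enum_rank \o f) => t w t_gt0 wP rep; apply: (fP t w) => // i.
exact/enum_rank_inj/rep.
Qed.

Lemma walk_colourable_fin (C : finType) (f : G -> C) :
  (forall t (w : (t + t).-tuple G), 0 < t -> is_walk w ->
    (forall i : 'I_t, f (tnth w (lshift t i)) = f (tnth w (rshift t i))) ->
    boring w) ->
  walk_colourable G #|C|.
Proof.
move=> fP; exists (enum_rank \o f) => t w t_gt0 wP rep; apply: fP => // i.
exact/enum_rank_inj/rep.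
Qed.

Variables (dep : G -> nat) (l : nat).
Hypothesis lay : layering setT dep l.+1.

Definition bag_index (x : G) : 'I_l.+1 := inord (index x (enum (bag setT dep x))).

Lemma bag_index_inj x y : y \in bag setT dep x -> bag_index x = bag_index y -> x = y.
Proof.
move=> yx; have y_in := yx; move: yx; rewrite inE => /andP[/eqP dy xy].
have sym : symmetric (below setT dep (dep x)).
  by move=> a b; rewrite /below /= adj_sym !in_setT /= [X in _ && X]andbC.
have bagE : bag setT dep y = bag setT dep x.
  by apply/setP => z; rewrite !inE dy (same_connect (sym_connect_sym sym) xy).
have x_in : x \in bag setT dep x by rewrite inE eqxx connect0.
have idx_lt z : z \in bag setT dep x -> index z (enum (bag setT dep x)) < l.+1.
  move=> z_in; apply: (@leq_trans #|bag setT dep x|).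
    by rewrite cardE index_mem mem_enum.
  by apply: lay.2; rewrite inE.
move/(congr1 val); rewrite /bag_index /= bagE !inordK ?idx_lt //.
by apply: index_inj; rewrite ?mem_enum.
Qed.

Definition layer_colour (x : G) : ('I_6 * bool) * 'I_l.+1 :=
  (depth_colour (dep x), bag_index x).

(** Take [j] minimizing the depth of [w j].  The depths of the two halves agree,
so the stretch from [w j] to [w (t + j)] witnesses that both lie in one bag. *)
Lemma layer_colour_meets (w : nat -> G) t : 0 < t ->
  (forall i, i.+1 < t + t -> adj (w i) (w i.+1)) ->
  (forall i, i < t -> layer_colour (w i) = layer_colour (w (t + i))) ->
  exists2 j, j < t & w j = w (t + j).
Proof.
move=> t_gt0 stp rep.
have dep_stp i : i.+1 < t + t ->
    dep (w i) <= (dep (w i.+1)).+1 /\ dep (w i.+1) <= (dep (w i)).+1.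
  move=> i_lt; have wi := stp i i_lt.
  by split; apply: lay.1; rewrite ?in_setT // adj_sym.
have dep_eq i : i < t -> dep (w i) = dep (w (t + i)).
  apply: (@lazy_walk_boring (dep \o w)) => // k k_lt.
  exact: (congr1 fst (rep k k_lt)).
have [j _ j_min] :=
  @arg_minnP _ (Ordinal t_gt0) predT (fun i : 'I_t => dep (w i)) isT.
have dep_ge i : i < t + t -> dep (w j) <= dep (w i).
  move=> i_lt; have [i_lt'|i_ge] := ltnP i t; first exact: (j_min (Ordinal i_lt')).
  have it : i - t < t by lia.
  by rewrite -(subnKC i_ge) -dep_eq //; apply: (j_min (Ordinal it)).
exists j => //; have idx_eq := congr1 snd (rep j (ltn_ord j)).
apply: bag_index_inj idx_eq; rewrite inE -(dep_eq j (ltn_ord j)) eqxx /=.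
have reach m : j + m < t + t ->
    connect (below setT dep (dep (w j))) (w j) (w (j + m)).
  elim: m => [|m IHm] m_lt; first by rewrite addn0 connect0.
  rewrite addnS in m_lt *; apply: connect_trans (IHm (ltnW m_lt)) (connect1 _).
  by rewrite /below /= stp // !in_setT !dep_ge // ltnW.
by rewrite addnC; apply: reach; rewrite ltn_add2r.
Qed.

Lemma path_colourable_layer : path_colourable G #|{: ('I_6 * bool) * 'I_l.+1}|.
Proof.
apply: (@path_colourable_fin _ layer_colour) => t w t_gt0 /andP[ww uw] rep.
have x0 := tnth w (lshift t (Ordinal t_gt0)).
have [|i i_lt|j j_lt] := @layer_colour_meets (nth x0 w) t t_gt0.
- by move=> i; apply: walk_stepP.
- by have := rep (Ordinal i_lt); have [-> ->] := tnth_halves w x0 (Ordinal i_lt).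
move/eqP; rewrite nth_uniq ?size_tuple //; lia.
Qed.

(** The extra colour [g] separates the neighbours of any one vertex, so an
equality [u i = u (t + i)] propagates to [i.+1] and to [i.-1]. *)
Lemma walk_colourable_layer d : (forall x : G, degree x <= d) ->
  walk_colourable G #|{: (('I_6 * bool) * 'I_l.+1) * 'I_(d * d).+1}|.
Proof.
move=> deg_le; pose r := [rel x y : G | [exists z, adj z x && adj z y]].
have r_sym : symmetric r.
  by move=> x y; apply/existsP/existsP => -[z]; rewrite andbC; exists z.
have r_le x : #|[set y | r x y]| <= d * d.
  apply: (@leq_trans (#|[set z | adj x z]| * d)); last first.
    by rewrite leq_mul2r deg_le orbT.
  apply: card_neighbours => // y; rewrite inE => /existsP[z /andP[zx zy]].
  by exists z; rewrite // inE adj_sym.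
have [g gP] := greedy_colouring r_sym r_le.
have g_inj x y z : adj z x -> adj z y -> g x = g y -> x = y.
  move=> zx zy; apply: contra_eq => xy; apply: gP => //.
  by apply/existsP; exists z; rewrite zx.
apply: (@walk_colourable_fin _ (fun x => (layer_colour x, g x))) => t w t_gt0 ww rep.
have x0 := tnth w (lshift t (Ordinal t_gt0)).
pose u := nth x0 w.
have stp i : i.+1 < t + t -> adj (u i) (u i.+1) by apply: walk_stepP.
have {}rep i : i < t -> layer_colour (u i) = layer_colour (u (t + i)) /\
    g (u i) = g (u (t + i)).
  move=> i_lt; have := rep (Ordinal i_lt).
  have [-> ->] := tnth_halves w x0 (Ordinal i_lt) => rep_i.
  by split; [apply: (congr1 fst rep_i)|apply: (congr1 snd rep_i)].
have [i i_lt|j j_lt uj] := @layer_colour_meets u t t_gt0 stp.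
  by have [] := rep i i_lt.
have up m : j + m < t -> u (j + m) = u (t + (j + m)).
  elim: m => [|m IHm]; first by rewrite addn0.
  rewrite !addnS => m_lt; have [_] := rep _ m_lt.
  rewrite addnS; apply: (g_inj _ _ (u (j + m))).
    by apply: stp; lia.
  by rewrite (IHm (ltnW m_lt)); apply: stp; lia.
have down m : m <= j -> u (j - m) = u (t + (j - m)).
  elim: m => [|m IHm] m_le; first by rewrite subn0.
  have jm : (j - m.+1).+1 = j - m by lia.
  have [|_ gE] := rep (j - m.+1); first by lia.
  apply: (g_inj _ _ (u (j - m))) gE.
    by rewrite adj_sym -jm; apply: stp; lia.
  rewrite (IHm (ltnW m_le)) -jm addnS adj_sym; apply: stp; lia.
move=> i; have [-> ->] := tnth_halves w x0 i; rewrite -/u.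
have [ij|ji] := leqP i j.
  by have := down (j - i) (leq_subr _ _); rewrite subKn.
by have := up (i - j); rewrite subnKC ?(ltnW ji) //; apply.
Qed.

End Colouring.

(** * Bounds on the chromatic numbers *)

Lemma pi_num_le G n : path_colourable G n -> pi_num G <= n.
Proof.
by move=> col; rewrite /pi_num; case: ex_minnP => m _; apply; apply/asboolP.
Qed.

Lemma sigma_num_le G n : walk_colourable G n -> sigma_num G <= n.
Proof.
by move=> col; rewrite /sigma_num; case: ex_minnP => m _; apply; apply/asboolP.
Qed.

Lemma treewidth_gt0 G : 0 < max_degree G -> 0 < treewidth G.
Proof.
rewrite /treewidth; case: ex_minnP => -[|//] /asboolP[H [[h h_inj h_adj] _ no_cl]] _.
rewrite /max_degree => deg_gt0.
have [x] : exists x : G, 0 < degree x.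
  apply/existsP; apply: contraLR deg_gt0 => /existsPn deg0; rewrite -leqNgt.
  by apply/bigmax_leqP => x _; rewrite leqNgt deg0.
rewrite card_gt0 => /set0Pn[y]; rewrite inE => /h_adj hxy.
have xy : h x != h y by apply: contraTneq hxy => ->; rewrite adj_irrefl.
case: (no_cl [set h x; h y]); last by rewrite cards2 xy.
by move=> a b /set2P[]-> /set2P[]->; rewrite ?eqxx // adj_sym.
Qed.

Theorem theorem3p3 :
  exists c : nat, forall (G : sgraph) (k D : nat),
    treewidth G = k -> max_degree G = D -> 1 <= D ->
    pi_num G <= c * k * D /\ sigma_num G <= c * k * D ^ 3.
Proof.
(* There are [12] colours of depths, [24 * k.+1 * D <= 48 * k * D] indices, and
   [D * D + 1 <= 2 * D ^ 2] colours for [g]. *)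
exists 1152 => G k D twG dG D_gt0.
have k_gt0 : 0 < k by rewrite -twG treewidth_gt0 ?dG.
have deg_le (x : G) : degree x <= D by rewrite -dG /max_degree leq_bigmax.
have tw_le : treewidth_le G k.
  by rewrite -twG /treewidth; case: ex_minnP => m /asboolP.
have sep S := treewidth_separation S tw_le.
have [|dep [lay _ _]] :=
  exists_layering (ltn0Sn k) D_gt0 deg_le sep (leqnn _) (sub0set [set: G]).
  by rewrite cards0.
have lE : 24 * k.+1 * D = (24 * k.+1 * D).-1.+1 by rewrite prednK // !muln_gt0 D_gt0.
rewrite lE in lay; split.
  apply: leq_trans (pi_num_le (path_colourable_layer lay)) _.
  rewrite !card_prod !card_ord card_bool -lE.
  have : k.+1 * D <= 2 * k * D by rewrite leq_mul2r; apply/orP; right; lia.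
  lia.
apply: leq_trans (sigma_num_le (walk_colourable_layer lay deg_le)) _.
rewrite !card_prod !card_ord card_bool -lE.
have kD : k.+1 * D <= 2 * k * D by rewrite leq_mul2r; apply/orP; right; lia.
have DD : (D * D).+1 <= 2 * (D * D) by nia.
have := leq_mul kD DD; rewrite !expnS expn0; lia.
Qed.
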